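(* Let $V$ be a vector space and let $\mathrm{As}^2(V)$ be the free algebra with two compatible associative products $\star_1,\star_2$ generated by $V$. Then, with respect to either one of the two products, $\mathrm{As}^2(V)$ is a free (non-unital) associative algebra.
   Context: Work over a field of characteristic zero. An algebra with two compatible associative products is a (not necessarily unital) vector space with two bilinear operations $\star_1,\star_2$ such that each is associative, $(a\star_i b)\star_i c=a\star_i(b\star_i c)$ for $i=1,2$, and $$(a\star_1 b)\star_2 c+(a\star_2 b)\star_1 c=a\star_1 (b\star_2 c)+a\star_2 (b\star_1 c).$$ $\mathrm{As}^2(V)$ denotes the free such algebra on $V$. The free non-unital associative algebra on a vector space $W$ is $\bigoplus_{k\ge1}W^{\otimes k}$ with the concatenation product. *)

(* Defs.v *)
From HB Require Import structures.
From mathcomp Require Import all_boot all_order all_algebra.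
From mathcomp Require Import boolp.

Set Implicit Arguments.
Unset Strict Implicit.
Unset Printing Implicit Defensive.
Import GRing.Theory.
Local Open Scope ring_scope.
Local Open Scope quotient_scope.

Record compat_alg (F : fieldType) := CompatAlg {
  compat_carrier :> lmodType F;
  prod1 : {bilinear compat_carrier -> compat_carrier -> compat_carrier};
  prod2 : {bilinear compat_carrier -> compat_carrier -> compat_carrier};
  prod1A : forall a b c, prod1 (prod1 a b) c = prod1 a (prod1 b c);
  prod2A : forall a b c, prod2 (prod2 a b) c = prod2 a (prod2 b c);
  prod12_compat : forall a b c,
    prod2 (prod1 a b) c + prod1 (prod2 a b) c =
    prod1 a (prod2 b c) + prod2 a (prod1 b c)
}.

Definition compat_morphism (F : fieldType) (A B : compat_alg F)
    (g : {linear A -> B}) : Prop :=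
  {morph g : x y / prod1 A x y >-> prod1 B x y} /\
  {morph g : x y / prod2 A x y >-> prod2 B x y}.

(* (A, i) is the free algebra with two compatible associative products
   generated by V, characterized up to unique isomorphism. *)
Definition is_As2 (F : fieldType) (V : lmodType F) (A : compat_alg F)
    (i : {linear V -> A}) : Prop :=
  forall (B : compat_alg F) (f : {linear V -> B}),
    (exists g : {linear A -> B}, compat_morphism g /\ g \o i =1 f) /\
    (forall g h : {linear A -> B}, compat_morphism g -> compat_morphism h ->
       g \o i =1 f -> h \o i =1 f -> g =1 h).

(* The underlying space of the tensor algebra without unit, the direct sum of
   the W^{(x)k} for k >= 1, is the free vector space on the disjoint union of
   the sets W^k, k >= 1, modulo the multilinearity relations. These relations
   relate words of the same length, so this is the usual quotient defining
   W^{(x)k} in each degree k. Elements of the free vector space are given by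
   formal sums of pairs (coefficient, word). *)
Section TensorAlgebra.
Variables (F : fieldType) (W : lmodType F).

(* (x, s) is the nonempty word x :: s *)
Definition word : Type := (W * seq W)%type.

Definition wcat (u v : word) : word := (u.1, u.2 ++ v.1 :: v.2).

(* the word p ++ x :: q *)
Definition wslot (p : seq W) (x : W) (q : seq W) : word :=
  if p is y :: p' then (y, p' ++ x :: q) else (x, q).

Definition fsum : Type := seq (F * word).

Inductive fsum_eq : fsum -> fsum -> Prop :=
| fsum_eq_refl s : fsum_eq s s
| fsum_eq_sym s t : fsum_eq s t -> fsum_eq t s
| fsum_eq_trans s t r : fsum_eq s t -> fsum_eq t r -> fsum_eq s r
| fsum_eq_cat s s' t t' :
    fsum_eq s s' -> fsum_eq t t' -> fsum_eq (s ++ t) (s' ++ t')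
| fsum_eq_catC s t : fsum_eq (s ++ t) (t ++ s)
| fsum_eq_coef0 w : fsum_eq [:: (0, w)] [::]
| fsum_eq_coefD a b w : fsum_eq [:: (a + b, w)] [:: (a, w); (b, w)]
| fsum_eq_slotD a p x y q :
    fsum_eq [:: (a, wslot p (x + y) q)]
            [:: (a, wslot p x q); (a, wslot p y q)]
| fsum_eq_slotZ a c p x q :
    fsum_eq [:: (a, wslot p (c *: x) q)] [:: (a * c, wslot p x q)].

Definition fsum_scale (c : F) (s : fsum) : fsum :=
  [seq (c * m.1, m.2) | m <- s].

Definition fsum_mul (s t : fsum) : fsum :=
  [seq (m.1 * n.1, wcat m.2 n.2) | m <- s, n <- t].

Lemma wcat_slotl p x q v : wcat (wslot p x q) v = wslot p x (q ++ v.1 :: v.2).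
Proof. by case: p => [|y p] //; rewrite /wcat /= -catA. Qed.

Lemma wcat_slotr p x q u : wcat u (wslot p x q) = wslot (u.1 :: u.2 ++ p) x q.
Proof. by case: p => [|y p]; rewrite /wcat /= ?cats0 // -catA. Qed.

Lemma wcatA u v w : wcat (wcat u v) w = wcat u (wcat v w).
Proof. by rewrite /wcat /= -catA. Qed.

Lemma fsum_eq_scale c s t :
  fsum_eq s t -> fsum_eq (fsum_scale c s) (fsum_scale c t).
Proof.
elim=> {s t} /=.
- by move=> s; apply: fsum_eq_refl.
- by move=> s t _; apply: fsum_eq_sym.
- by move=> s t r _ IH _; apply: fsum_eq_trans.
- by move=> s s' t t' _ IH1 _ IH2; rewrite /fsum_scale !map_cat;
     apply: fsum_eq_cat.
- by move=> s t; rewrite /fsum_scale !map_cat; apply: fsum_eq_catC.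
- by move=> w; rewrite /= mulr0; apply: fsum_eq_coef0.
- by move=> a b w; rewrite mulrDr; apply: fsum_eq_coefD.
- by move=> a p x y q; apply: fsum_eq_slotD.
- by move=> a d p x q; rewrite mulrA; apply: fsum_eq_slotZ.
Qed.

Lemma fsum_mul_catl s s' t :
  fsum_mul (s ++ s') t = fsum_mul s t ++ fsum_mul s' t.
Proof. exact: allpairs_cat. Qed.

Lemma fsum_mul_cons m s t :
  fsum_mul (m :: s) t = fsum_mul [:: m] t ++ fsum_mul s t.
Proof. by rewrite -cat1s fsum_mul_catl. Qed.

Lemma fsum_mul1 m t :
  fsum_mul [:: m] t = [seq (m.1 * n.1, wcat m.2 n.2) | n <- t].
Proof. by rewrite /fsum_mul /= cats0. Qed.

Lemma fsum_eq_catACA s t s' t' :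
  fsum_eq ((s ++ t) ++ (s' ++ t')) ((s ++ s') ++ (t ++ t')).
Proof.
rewrite -!catA; apply: fsum_eq_cat; first exact: fsum_eq_refl.
by rewrite !catA; apply: fsum_eq_cat; [apply: fsum_eq_catC|apply: fsum_eq_refl].
Qed.

Lemma fsum_mul_catr s t t' :
  fsum_eq (fsum_mul s (t ++ t')) (fsum_mul s t ++ fsum_mul s t').
Proof.
elim: s => [|m s IH]; first exact: fsum_eq_refl.
rewrite !(fsum_mul_cons m s) !fsum_mul1 map_cat.
apply: fsum_eq_trans (fsum_eq_catACA _ _ _ _).
by apply: fsum_eq_cat => //; apply: fsum_eq_refl.
Qed.

Lemma fsum_eq_mulr s t t' :
  fsum_eq t t' -> fsum_eq (fsum_mul s t) (fsum_mul s t').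
Proof.
move=> tt'; elim: s => [|m s IH]; first exact: fsum_eq_refl.
rewrite !(fsum_mul_cons m s); apply: fsum_eq_cat => // {s IH}.
rewrite !fsum_mul1; case: m => c u /=.
elim: tt' => {t t'} /=.
- by move=> s; apply: fsum_eq_refl.
- by move=> s t _; apply: fsum_eq_sym.
- by move=> s t r _ IH _; apply: fsum_eq_trans.
- by move=> s s' t t' _ IH1 _ IH2; rewrite !map_cat; apply: fsum_eq_cat.
- by move=> s t; rewrite !map_cat; apply: fsum_eq_catC.
- by move=> w; rewrite mulr0; apply: fsum_eq_coef0.
- by move=> a b w; rewrite mulrDr; apply: fsum_eq_coefD.
- by move=> a p x y q; rewrite !wcat_slotr; apply: fsum_eq_slotD.
- by move=> a d p x q; rewrite !wcat_slotr mulrA; apply: fsum_eq_slotZ.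
Qed.

Lemma fsum_eq_mull s s' t :
  fsum_eq s s' -> fsum_eq (fsum_mul s t) (fsum_mul s' t).
Proof.
elim=> {s s'}.
- by move=> s; apply: fsum_eq_refl.
- by move=> s r _; apply: fsum_eq_sym.
- by move=> s s' r _ IH _; apply: fsum_eq_trans.
- by move=> s s' r r' _ IH1 _ IH2; rewrite !fsum_mul_catl; apply: fsum_eq_cat.
- by move=> s r; rewrite !fsum_mul_catl; apply: fsum_eq_catC.
- move=> w; rewrite fsum_mul1; elim: t => [|n t IH] /=;
    first exact: fsum_eq_refl.
  rewrite mul0r; apply: (fsum_eq_cat (s := [:: _]) (s' := [::])) => //.
  exact: fsum_eq_coef0.
- move=> a b w; rewrite (fsum_mul_cons (a, w)) !fsum_mul1.
  elim: t => [|n t IH] /=; first exact: fsum_eq_refl.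
  apply: fsum_eq_trans (fsum_eq_catACA [:: _] [:: _] _ _).
  apply: (fsum_eq_cat (s := [:: _])) => //=.
  by rewrite mulrDl; apply: fsum_eq_coefD.
- move=> a p x y q; rewrite (fsum_mul_cons (a, wslot p x q)) !fsum_mul1.
  elim: t => [|n t IH] /=; first exact: fsum_eq_refl.
  apply: fsum_eq_trans (fsum_eq_catACA [:: _] [:: _] _ _).
  apply: (fsum_eq_cat (s := [:: _])) => //=.
  by rewrite !wcat_slotl; apply: fsum_eq_slotD.
- move=> a c p x q; rewrite !fsum_mul1.
  elim: t => [|n t IH] /=; first exact: fsum_eq_refl.
  apply: (fsum_eq_cat (s := [:: _]) (s' := [:: _])) => //.
  by rewrite !wcat_slotl mulrAC; apply: fsum_eq_slotZ.
Qed.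

Definition fsum_eqb : rel fsum := fun s t => `[< fsum_eq s t >].

Lemma fsum_eqb_equiv : equiv_class_of fsum_eqb.
Proof.
split=> [s|s t|t s r].
- by apply/asboolP/fsum_eq_refl.
- by apply/asboolP/asboolP => /fsum_eq_sym.
- by move=> /asboolP st /asboolP tr; apply/asboolP/(fsum_eq_trans st tr).
Qed.

Canonical fsum_equiv := EquivRelPack fsum_eqb_equiv.

Definition tensor_alg : Type := {eq_quot fsum_equiv}.
HB.instance Definition _ : EqQuotient _ fsum_equiv tensor_alg :=
  EqQuotient.on tensor_alg.
HB.instance Definition _ := Choice.on tensor_alg.

Lemma tensor_eqP (s t : fsum) :
  \pi_tensor_alg s = \pi_tensor_alg t <-> fsum_eq s t.
Proof. by split=> [/eqmodP/asboolP|st] //; apply/eqmodP/asboolP. Qed.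

Lemma fsum_eq_repr s : fsum_eq (repr (\pi_tensor_alg s)) s.
Proof. by apply/tensor_eqP; rewrite reprK. Qed.

Definition tensor_zero : tensor_alg := \pi_tensor_alg [::].
Definition tensor_add := lift_op2 tensor_alg (fun s t : fsum => s ++ t).
Definition tensor_scale (c : F) := lift_op1 tensor_alg (fsum_scale c).
Definition tensor_opp (x : tensor_alg) : tensor_alg := tensor_scale (- 1) x.
(* the concatenation product *)
Definition tensor_mul := lift_op2 tensor_alg fsum_mul.

Lemma pi_tensor_add s t :
  tensor_add (\pi_tensor_alg s) (\pi_tensor_alg t) = \pi_tensor_alg (s ++ t).
Proof.
rewrite /tensor_add -lock.
by apply/tensor_eqP/fsum_eq_cat; apply: fsum_eq_repr.
Qed.

Lemma pi_tensor_scale c s :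
  tensor_scale c (\pi_tensor_alg s) = \pi_tensor_alg (fsum_scale c s).
Proof.
by rewrite /tensor_scale -lock; apply/tensor_eqP/fsum_eq_scale/fsum_eq_repr.
Qed.

Lemma pi_tensor_mul s t :
  tensor_mul (\pi_tensor_alg s) (\pi_tensor_alg t) =
  \pi_tensor_alg (fsum_mul s t).
Proof.
rewrite /tensor_mul -lock; apply/tensor_eqP.
apply: fsum_eq_trans (fsum_eq_mulr _ (fsum_eq_repr t)).
exact/fsum_eq_mull/fsum_eq_repr.
Qed.

Lemma tensor_addA : associative tensor_add.
Proof.
by elim/quotW=> s; elim/quotW=> t; elim/quotW=> r; rewrite !pi_tensor_add catA.
Qed.

Lemma tensor_addC : commutative tensor_add.
Proof.
elim/quotW=> s; elim/quotW=> t; rewrite !pi_tensor_add.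
exact/tensor_eqP/fsum_eq_catC.
Qed.

Lemma tensor_add0 : left_id tensor_zero tensor_add.
Proof. by elim/quotW=> s; rewrite pi_tensor_add. Qed.

Lemma fsum_scaleDl a b s :
  fsum_eq (fsum_scale (a + b) s) (fsum_scale a s ++ fsum_scale b s).
Proof.
elim: s => [|[c w] s IH]; first exact: fsum_eq_refl.
rewrite /=; apply: fsum_eq_trans (fsum_eq_catACA [:: _] [:: _] _ _).
apply: (fsum_eq_cat (s := [:: _])) => //=.
by rewrite mulrDl; apply: fsum_eq_coefD.
Qed.

Lemma fsum_scale0 s : fsum_eq (fsum_scale 0 s) [::].
Proof.
elim: s => [|[c w] s IH]; first exact: fsum_eq_refl.
rewrite /= mul0r; apply: (fsum_eq_cat (s := [:: _]) (s' := [::])) => //.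
exact: fsum_eq_coef0.
Qed.

Lemma fsum_scale1 s : fsum_scale 1 s = s.
Proof. by elim: s => //= -[c w] s ->; rewrite mul1r. Qed.

Lemma tensor_addN : left_inverse tensor_zero tensor_opp tensor_add.
Proof.
elim/quotW=> s; rewrite /tensor_opp pi_tensor_scale pi_tensor_add.
apply/tensor_eqP; rewrite -[in X in fsum_eq (_ ++ X) _](fsum_scale1 s).
apply: fsum_eq_trans (fsum_eq_sym (fsum_scaleDl _ _ _)) _.
by rewrite addNr; apply: fsum_scale0.
Qed.

HB.instance Definition _ := GRing.isZmodule.Build tensor_alg
  tensor_addA tensor_addC tensor_add0 tensor_addN.

Lemma tensor_scaleA a b x :
  tensor_scale a (tensor_scale b x) = tensor_scale (a * b) x.
Proof.
elim/quotW: x => s; rewrite !pi_tensor_scale /fsum_scale -map_comp.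
by congr (\pi_tensor_alg _); apply: eq_map => m /=; rewrite mulrA.
Qed.

Lemma tensor_scale1 : left_id 1 tensor_scale.
Proof. by elim/quotW=> s; rewrite pi_tensor_scale fsum_scale1. Qed.

Lemma tensor_scaleDr : right_distributive tensor_scale tensor_add.
Proof.
move=> c; elim/quotW=> s; elim/quotW=> t.
by rewrite !(pi_tensor_add, pi_tensor_scale) /fsum_scale map_cat.
Qed.

Lemma tensor_scaleDl x : {morph tensor_scale^~ x : a b / a + b >-> tensor_add a b}.
Proof.
move=> a b; elim/quotW: x => s; rewrite !(pi_tensor_scale, pi_tensor_add).
exact/tensor_eqP/fsum_scaleDl.
Qed.

HB.instance Definition _ := GRing.Zmodule_isLmodule.Build F tensor_alg
  tensor_scaleA tensor_scale1 tensor_scaleDr tensor_scaleDl.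

End TensorAlgebra.

Definition is_free_assoc (F : fieldType) (A : lmodType F)
    (mul : A -> A -> A) : Prop :=
  exists (W : lmodType F) (phi : {linear tensor_alg W -> A}),
    bijective phi /\ {morph phi : x y / tensor_mul x y >-> mul x y}.

(* Main.v *)
Require Import Defs.
From HB Require Import structures.
From mathcomp Require Import all_boot all_order all_algebra.
From mathcomp Require Import boolp.

(** Let A be the free algebra with two compatible associative products on V,
    with generating map i, and let W be the right ideal for the second product
    generated by i(V), that is, the smallest subspace of A that contains i(V)
    and is stable under w |-> w *2 a. Then W freely generates A for the first
    product.

    Let T be the tensor algebra of W, with concatenation written ** below, and
    let phi : T -> A be the map that extends the inclusion of W to a morphism
    for the first product. The point is that T carries a second product ##, for
    which it is an algebra with two compatible products and phi is a morphism.
    On a generator w this product is read off in A: w ## y is the generator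
    w *2 phi y, which lies in W since W is a right ideal. On longer words it is
    forced by compatibility:
      (w ** x) ## y = w ** (x ## y) + w ## (x ** y) - (w ## x) ** y.
    Since w ## y uses y only through phi y, this is a recursion on the length
    of the left factor alone. Compatibility ([tensor_mul12_compat]) and
    associativity ([tensor_mul2A]) then follow by induction on the left factor;
    the first holds almost by construction, and the second reduces to
    compatibility.

    Freeness of A gives a morphism psi : A -> T for both products that sends
    i v to the generator i v. By uniqueness phi \o psi is the identity of A.
    Conversely, psi w is the generator w for all w in W, since the w with this
    property form a right ideal containing i(V):
      psi (w *2 a) = w ## psi a = w *2 phi (psi a) = w *2 a.
    So psi \o phi is a morphism for concatenation that fixes the generators,
    hence the identity, and phi is an isomorphism. The other product is treated
    by exchanging the roles of the two products. *)

Set Implicit Arguments.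
Unset Strict Implicit.
Unset Printing Implicit Defensive.
Import GRing.Theory.
Local Open Scope ring_scope.
Local Open Scope quotient_scope.

Lemma addrDB_interchange (G : zmodType) (a a' b b' c c' : G) :
  (a + a') + (b + b') - (c + c') = (a + b - c) + (a' + b' - c').
Proof. by rewrite opprD (addrACA a) (addrACA (a + b)). Qed.

(** * The tensor algebra: induction and recursion on words *)

Section TensorTheory.
Variables (F : fieldType) (W : lmodType F).
Local Notation T := (tensor_alg W).
Local Notation "x ** y" := (tensor_mul x y) (at level 40, left associativity).

Definition tensor_word (w : word W) : T := \pi_T [:: (1, w)].

Definition tensor_gen (w : W) : T := tensor_word (w, [::]).

Lemma pi_tensor_cons c w s :
  \pi_T ((c, w) :: s) = c *: tensor_word w + \pi_T s.
Proof.
by rewrite /GRing.scale /= pi_tensor_scale [RHS]pi_tensor_add /= mulr1.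
Qed.

Lemma tensor_word_cons w w' s :
  tensor_word (w, w' :: s) = tensor_gen w ** tensor_word (w', s).
Proof. by rewrite pi_tensor_mul /fsum_mul /= mulr1. Qed.

Lemma tensor_word_linear c p x y q :
  tensor_word (wslot p (c *: x + y) q) =
  c *: tensor_word (wslot p x q) + tensor_word (wslot p y q).
Proof.
rewrite /GRing.scale /= pi_tensor_scale [RHS]pi_tensor_add /= mulr1.
apply/tensor_eqP/(fsum_eq_trans (fsum_eq_slotD _ _ _ _ _)).
apply: (fsum_eq_cat (s := [:: _]) (s' := [:: _])); last exact: fsum_eq_refl.
apply: fsum_eq_trans (fsum_eq_slotZ _ _ _ _ _) _.
by rewrite mul1r; apply: fsum_eq_refl.
Qed.

Lemma tensor_gen_is_linear : linear tensor_gen.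
Proof. by move=> c x y; apply: (tensor_word_linear c [::] x y [::]). Qed.

HB.instance Definition _ :=
  GRing.isLinear.Build F W T *:%R tensor_gen tensor_gen_is_linear.

Lemma tensor_mulA : associative (@tensor_mul F W).
Proof.
elim/quotW=> s; elim/quotW=> t; elim/quotW=> r; rewrite !pi_tensor_mul.
congr (\pi_T _); elim: s => [|m s IH] //.
rewrite (fsum_mul_cons m s (fsum_mul t r)) (fsum_mul_cons m s t) fsum_mul_catl.
rewrite -IH {IH}; congr (_ ++ _); rewrite !fsum_mul1.
elim: t => [|n t IH] //.
rewrite (fsum_mul_cons n t r) map_cat IH map_cons (fsum_mul_cons _ (map _ t)).
rewrite !fsum_mul1 -map_comp; congr (_ ++ _).
by apply: eq_map => k /=; rewrite mulrA wcatA.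
Qed.

Lemma tensor_mul_bilinear :
  bilinear_for (GRing.Scale.Law.clone _ _ *:%R _)
    (GRing.Scale.Law.clone _ _ *:%R _) (@tensor_mul F W).
Proof.
split=> [z|z] c x y; elim/quotW: x => s; elim/quotW: y => t; elim/quotW: z => r;
  rewrite /GRing.scale /GRing.add /= !(pi_tensor_scale, pi_tensor_add, pi_tensor_mul).
- rewrite fsum_mul_catl; apply/tensor_eqP/fsum_eq_cat; last exact: fsum_eq_refl.
  elim: s => [|m s IH]; first exact: fsum_eq_refl.
  rewrite /= fsum_mul_cons (fsum_mul_cons m s) /fsum_scale map_cat.
  apply: fsum_eq_cat => //; rewrite !fsum_mul1 -map_comp.
  under eq_map do rewrite /= -mulrA; exact: fsum_eq_refl.
- apply/tensor_eqP/(fsum_eq_trans (fsum_mul_catr _ _ _)).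
  apply: fsum_eq_cat; last exact: fsum_eq_refl.
  elim: r => [|m r IH]; first exact: fsum_eq_refl.
  rewrite !(fsum_mul_cons m r) /fsum_scale map_cat.
  apply: fsum_eq_cat => //; rewrite !fsum_mul1 -!map_comp.
  under eq_map do rewrite /= mulrCA; exact: fsum_eq_refl.
Qed.

HB.instance Definition _ :=
  bilinear_isBilinear.Build F T T T _ _ (@tensor_mul F W) tensor_mul_bilinear.

(** The case of 0 is absent because stability under c *: x + y yields it from
    any element satisfying P. *)
Lemma tensor_word_ind (P : T -> Prop) :
  (forall c x y, P x -> P y -> P (c *: x + y)) ->
  (forall u, P (tensor_word u)) -> forall x, P x.
Proof.
move=> PD Pword; elim/quotW; elim=> [|[c u] s IH]; last first.
  by rewrite pi_tensor_cons; apply: PD.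
suff: P 0 by [].
by rewrite -(addNr (tensor_gen 0)) -scaleN1r; apply: PD; apply: Pword.
Qed.

Lemma tensor_ind (P : T -> Prop) :
  (forall c x y, P x -> P y -> P (c *: x + y)) ->
  (forall w, P (tensor_gen w)) ->
  (forall w x, P x -> P (tensor_gen w ** x)) ->
  forall x, P x.
Proof.
move=> PD Pgen Pmul; apply: tensor_word_ind => // -[w s].
elim: s w => [|w' s IH] w; first exact: Pgen.
by rewrite tensor_word_cons; apply: Pmul.
Qed.

(** Linear recursion on words. The step receives the tail of the word as an
    element of T besides the value on that tail, so that only dependence on the
    head and joint dependence on the pair (tail, value) must be linear. The
    second product defined further on refers to the tail in this way. *)
Section Recursion.
Variables (U : lmodType F) (base : W -> U) (step : W -> T -> U -> U).

Fixpoint seq_rec (w : W) (s : seq W) : U :=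
  if s is w' :: s' then step w (tensor_word (w', s')) (seq_rec w' s')
  else base w.

Definition word_rec (u : word W) : U := seq_rec u.1 u.2.

Definition fsum_rec (s : fsum W) : U := \sum_(m <- s) m.1 *: word_rec m.2.

Definition tensor_rec (x : T) : U := fsum_rec (repr x).

Hypothesis base_linear : linear base.
Hypothesis step_linearl : forall t u, linear (fun w => step w t u).
Hypothesis step_linearr : forall w c t t' u u',
  step w (c *: t + t') (c *: u + u') = c *: step w t u + step w t' u'.

(** Multilinearity of the function on words, by induction on the prefix before
    the slot: the slot at the head uses linearity of the step in the head, and a
    later slot changes the tail and the value on it in the same linear way. *)
Lemma word_rec_linear c p x y q :
  word_rec (wslot p (c *: x + y) q) =
  c *: word_rec (wslot p x q) + word_rec (wslot p y q).
Proof.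
have head w s : word_rec (w, s) = seq_rec w s by [].
case: p => [|z p].
  by rewrite /wslot !head; case: q => [|w q] /=; rewrite ?base_linear ?step_linearl.
elim: p z => [|z' p IH] z.
  rewrite !head /= (tensor_word_linear c [::]) -step_linearr.
  by congr (step _ _ _); case: q => [|w q] /=; rewrite ?base_linear ?step_linearl.
move: (IH z'); rewrite !head /= => ->.
by rewrite (tensor_word_linear c (z' :: p)) step_linearr.
Qed.

Lemma fsum_rec_eq s t : fsum_eq s t -> fsum_rec s = fsum_rec t.
Proof.
rewrite /fsum_rec; elim=> {s t} //.
- by move=> s t r _ -> _.
- by move=> s s' t t' _ IH1 _ IH2; rewrite !big_cat IH1 IH2.
- by move=> s t; rewrite !big_cat /= addrC.
- by move=> w; rewrite big_seq1 big_nil scale0r.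
- by move=> a b w; rewrite !big_cons !big_nil !addr0 scalerDl.
- move=> a p x y q; rewrite !big_cons !big_nil !addr0 /=.
  by rewrite -{1}[x]scale1r word_rec_linear scale1r scalerDr.
- move=> a c p x q; rewrite !big_seq1 /= -scalerA.
  (* the value with 0 in a slot is - a + a for some a *)
  have word_rec0 : word_rec (wslot p 0 q) = 0.
    have := word_rec_linear (-1) p 0 0 q.
    by rewrite scaler0 addr0 scaleN1r addNr.
  by rewrite -[c *: x]addr0 word_rec_linear word_rec0 addr0.
Qed.

Lemma tensor_rec_pi s : tensor_rec (\pi_T s) = fsum_rec s.
Proof. exact/fsum_rec_eq/fsum_eq_repr. Qed.

Lemma tensor_rec_linear : linear tensor_rec.
Proof.
move=> c x y; elim/quotW: x => s; elim/quotW: y => t.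
rewrite {1}/GRing.scale {1}/GRing.add /= pi_tensor_scale pi_tensor_add.
rewrite !tensor_rec_pi /fsum_rec big_cat big_map scaler_sumr; congr (_ + _).
by apply: eq_bigr => m _; rewrite scalerA.
Qed.

Lemma tensor_rec_word w : tensor_rec (tensor_word w) = word_rec w.
Proof. by rewrite tensor_rec_pi /fsum_rec big_seq1 scale1r. Qed.

Lemma tensor_rec_gen w : tensor_rec (tensor_gen w) = base w.
Proof. exact: tensor_rec_word. Qed.

Lemma tensor_rec_mul w x :
  tensor_rec (tensor_gen w ** x) = step w x (tensor_rec x).
Proof.
elim/tensor_word_ind: x => [c x y IHx IHy|[w' s]].
  by rewrite linearPr !tensor_rec_linear IHx IHy step_linearr.
by rewrite -tensor_word_cons !tensor_rec_word.
Qed.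

End Recursion.

(** The universal property of the tensor algebra. *)
Section Extension.
Variables (U : lmodType F) (mul : {bilinear U -> U -> U}).
Hypothesis mulA : associative mul.
Variable f : {linear W -> U}.

Definition tensor_ext : T -> U := tensor_rec f (fun w _ => mul (f w)).

Let ext_stepl (t : T) (u : U) : linear (fun w => mul (f w) u).
Proof. by move=> c x y; rewrite linearP linearPl. Qed.

Let ext_stepr w c (t t' : T) u u' :
  mul (f w) (c *: u + u') = c *: mul (f w) u + mul (f w) u'.
Proof. exact: linearPr. Qed.

Lemma tensor_ext_is_linear : linear tensor_ext.
Proof. exact: (tensor_rec_linear (linearP f) ext_stepl ext_stepr). Qed.

HB.instance Definition _ :=
  GRing.isLinear.Build F T U *:%R tensor_ext tensor_ext_is_linear.

Lemma tensor_ext_gen w : tensor_ext (tensor_gen w) = f w.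
Proof. exact: (tensor_rec_gen (linearP f) ext_stepl ext_stepr). Qed.

Lemma tensor_extM : {morph tensor_ext : x y / x ** y >-> mul x y}.
Proof.
have extM1 w x : tensor_ext (tensor_gen w ** x) = mul (f w) (tensor_ext x).
  exact: (tensor_rec_mul (linearP f) ext_stepl ext_stepr).
move=> x y; elim/tensor_ind: x => [c x x' IH IH'|w|w x IH].
- by rewrite linearPl /= 2!linearP /= IH IH' linearPl.
- by rewrite extM1 tensor_ext_gen.
- by rewrite -tensor_mulA !extM1 IH mulA.
Qed.

End Extension.
End TensorTheory.

Arguments tensor_ext {F W U} mul f _.

(** * A compatible product on a tensor algebra *)

(** The subspace W of A is replaced by any right module over A, for the second
    product, with a module morphism f to A. *)
Section CompatTensor.
Variables (F : fieldType) (A : compat_alg F) (W : lmodType F).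
Variables (f : {linear W -> A}) (act : {bilinear W -> A -> W}).
Hypothesis f_act : forall w a, f (act w a) = prod2 A (f w) a.
Hypothesis actA : forall w a b, act (act w a) b = act w (prod2 A a b).
Local Notation T := (tensor_alg W).
Local Notation "x ** y" := (tensor_mul x y) (at level 40, left associativity).
Local Notation phi := (tensor_ext (prod1 A) f).

(** The step of the recursion is the value on w ** t that compatibility
    dictates, with u standing for the product of t and y. *)
Definition tensor_mul2 (x y : T) : T :=
  tensor_rec (fun w => tensor_gen (act w (phi y)))
    (fun w t u => tensor_gen w ** u + tensor_gen (act w (phi (t ** y)))
                  - tensor_gen (act w (phi t)) ** y) x.

Local Notation "x ## y" := (tensor_mul2 x y) (at level 40, left associativity).

Let base_linear a : linear (fun w => tensor_gen (act w a)).
Proof. by move=> c w w'; rewrite linearPl linearP. Qed.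

Let step_linearl y t u : linear (fun w => tensor_gen w ** u
  + tensor_gen (act w (phi (t ** y))) - tensor_gen (act w (phi t)) ** y).
Proof.
move=> c w w'; rewrite !base_linear linearP !linearPl /=.
by rewrite scalerBr scalerDr addrDB_interchange.
Qed.

Let step_linearr y w c t t' u u' :
  tensor_gen w ** (c *: u + u')
    + tensor_gen (act w (phi ((c *: t + t') ** y)))
    - tensor_gen (act w (phi (c *: t + t'))) ** y =
  c *: (tensor_gen w ** u + tensor_gen (act w (phi (t ** y)))
        - tensor_gen (act w (phi t)) ** y)
  + (tensor_gen w ** u' + tensor_gen (act w (phi (t' ** y)))
     - tensor_gen (act w (phi t')) ** y).
Proof.
rewrite linearPr linearPl /= 2!(linearP phi) 2!(linearPr act).
rewrite 2!(linearP (@tensor_gen F W)) linearPl /=.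
by rewrite scalerBr scalerDr addrDB_interchange.
Qed.

Lemma tensor_mul2Pl y c x x' : (c *: x + x') ## y = c *: (x ## y) + x' ## y.
Proof.
exact: (tensor_rec_linear (base_linear _) (step_linearl _) (step_linearr _)).
Qed.

Lemma tensor_mul2_gen w y : tensor_gen w ## y = tensor_gen (act w (phi y)).
Proof.
exact: (tensor_rec_gen (base_linear _) (step_linearl _) (step_linearr _)).
Qed.

Lemma tensor_mul2_mulgen w x y :
  (tensor_gen w ** x) ## y =
  tensor_gen w ** (x ## y) + tensor_gen w ## (x ** y)
  - (tensor_gen w ## x) ** y.
Proof.
rewrite !tensor_mul2_gen.
exact: (tensor_rec_mul (base_linear _) (step_linearl _) (step_linearr _)).
Qed.

Lemma tensor_mul2Pr x c y y' : x ## (c *: y + y') = c *: (x ## y) + x ## y'.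
Proof.
elim/tensor_ind: x => [d x x' IH IH'|w|w x IH].
- rewrite !tensor_mul2Pl IH IH' !scalerDr !scalerA (mulrC d) -!addrA.
  by congr (_ + _); rewrite addrCA.
- by rewrite !tensor_mul2_gen linearP linearPr linearP.
- rewrite !tensor_mul2_mulgen !tensor_mul2_gen IH !linearPr /=.
  rewrite (linearP phi) (linearPr act) linearP /=.
  by rewrite scalerBr scalerDr addrDB_interchange.
Qed.

Lemma tensor_mul2_bilinear :
  bilinear_for (GRing.Scale.Law.clone _ _ *:%R _)
    (GRing.Scale.Law.clone _ _ *:%R _) tensor_mul2.
Proof. by split=> [y|x] c u v; [apply: tensor_mul2Pl | apply: tensor_mul2Pr]. Qed.

HB.instance Definition _ :=
  bilinear_isBilinear.Build F T T T _ _ tensor_mul2 tensor_mul2_bilinear.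

(** For a generator x this is the defining recursion. If it holds for x, then
    in the expansion of both sides for w ** x the terms where w multiplies a
    whole product match by the hypothesis, the two occurrences of
    (w ## (x ** y)) ** z cancel, and the remaining terms are the same. *)
Lemma tensor_mul12_compat x y z :
  (x ** y) ## z + (x ## y) ** z = x ** (y ## z) + x ## (y ** z).
Proof.
elim/tensor_ind: x => [c x x' IH IH'|w|w x IH].
- rewrite !(linearPl, tensor_mul2Pl) /= addrACA -scalerDr IH IH'.
  by rewrite scalerDr addrACA.
- by rewrite tensor_mul2_mulgen subrK.
rewrite -tensor_mulA !tensor_mul2_mulgen linearBl linearDl /= -!tensor_mulA.
have {IH} := congr1 (tensor_mul (tensor_gen w)) IH.
rewrite !linearDr /= => IH.
rewrite [RHS]addrA [X in _ = X - _]addrA -IH !addrA; congr (_ - _).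
by rewrite addrAC subrK addrAC.
Qed.

(** By induction on the left factor: A satisfies the relation that defines the
    product of a word by y. *)
Lemma tensor_ext_mul2 : {morph phi : x y / x ## y >-> prod2 A x y}.
Proof.
have phi1 := tensor_extM (fun a b c => esym (@prod1A F A a b c)) f.
move=> x y; elim/tensor_ind: x => [c x x' IH IH'|w|w x IH].
- by rewrite tensor_mul2Pl !linearP /= IH IH' linearPl.
- by rewrite tensor_mul2_gen !tensor_ext_gen f_act.
rewrite tensor_mul2_mulgen linearB linearD /= !phi1 !tensor_mul2_gen.
rewrite !tensor_ext_gen !f_act IH !phi1.
by rewrite -prod12_compat addrK.
Qed.

(** For a generator w, both sides are the generator given by w acted on by
    phi y *2 phi z, because phi is a morphism for this product. For w ** x, both
    sides expand by compatibility; after the induction hypothesis for x and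
    associativity for the left factor w, what is left is w ## applied to the
    compatibility relation of x, y and z. *)
Lemma tensor_mul2A : associative tensor_mul2.
Proof.
have mul2_mul a b c : (a ** b) ## c = a ** (b ## c) + a ## (b ** c) - (a ## b) ** c.
  by rewrite -tensor_mul12_compat addrK.
have genA w y z : tensor_gen w ## (y ## z) = tensor_gen w ## y ## z.
  by rewrite !tensor_mul2_gen tensor_ext_mul2 actA.
move=> x y z; elim/tensor_ind: x => [c x x' IH IH'|w|w x IH].
- by rewrite !tensor_mul2Pl IH IH'.
- exact: genA.
rewrite (mul2_mul _ x) [in RHS](mul2_mul _ x) linearBl linearDl /= -genA.
rewrite (mul2_mul (tensor_gen w) (x ## y) z) (mul2_mul (tensor_gen w ## x) y z).
rewrite -!genA -IH.
(* Compatibility of x, y and z, under multiplication by w on the left. *)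
have -> : tensor_gen w ## (x ** (y ## z)) =
    tensor_gen w ## ((x ** y) ## z) + tensor_gen w ## ((x ## y) ** z)
    - tensor_gen w ## (x ## (y ** z)).
  by rewrite -linearDr tensor_mul12_compat linearDr addrK.
rewrite opprB !addrA [RHS](ACl (1*2*4*3*5*6)%AC) /= subrK opprD addrA.
by rewrite [RHS](ACl (1*3*2*5*4)%AC).
Qed.

(** Transparent, because its carrier and products must unfold to those of the
    tensor algebra. *)
Definition compat_tensor : compat_alg F.
Proof.
refine (@CompatAlg F T (@tensor_mul F W) tensor_mul2 _ _ tensor_mul12_compat).
- by move=> a b c; rewrite /= tensor_mulA.
- by move=> a b c; rewrite /= tensor_mul2A.
Defined.

Lemma tensor_ext_compat : compat_morphism (phi : {linear compat_tensor -> A}).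
Proof.
split; last exact: tensor_ext_mul2.
exact: (tensor_extM (fun a b c => esym (@prod1A F A a b c))).
Qed.

End CompatTensor.

(** * The right ideal generated by V, and freeness *)

Section RightIdeal.
Variables (F : fieldType) (V : lmodType F) (A : compat_alg F).
Variable i : {linear V -> A}.

Inductive right_ideal : A -> Prop :=
| right_ideal_gen v : right_ideal (i v)
| right_ideal_lin c x y :
    right_ideal x -> right_ideal y -> right_ideal (c *: x + y)
| right_ideal_mul x a : right_ideal x -> right_ideal (prod2 A x a).

Definition right_ideal_pred : {pred A} := fun x => `[< right_ideal x >].

Lemma right_ideal_submod : GRing.submod_closed right_ideal_pred.
Proof.
split=> [|c x y /asboolP Rx /asboolP Ry].
  by rewrite -(linear0 i); apply/asboolP/right_ideal_gen.
exact/asboolP/right_ideal_lin.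
Qed.

HB.instance Definition _ := GRing.isSubmodClosed.Build F A right_ideal_pred
  (GRing.submod_closed_semi right_ideal_submod).

Record ideal := Ideal { ideal_val : A; _ : ideal_val \in right_ideal_pred }.

HB.instance Definition _ := [isSub for ideal_val].
HB.instance Definition _ := [Choice of ideal by <:].
HB.instance Definition _ := [SubChoice_isSubLmodule of ideal by <:].

Lemma ideal_right (w : ideal) : right_ideal (val w).
Proof. exact/asboolP/(valP w). Qed.

Definition ideal_act (w : ideal) (a : A) : ideal :=
  Ideal (asboolT (right_ideal_mul a (ideal_right w))).

Lemma ideal_act_bilinear :
  bilinear_for (GRing.Scale.Law.clone _ _ *:%R _)
    (GRing.Scale.Law.clone _ _ *:%R _) ideal_act.
Proof.
split=> [a|w] c x y; apply: val_inj; first exact: (linearPl (prod2 A)).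
exact: (linearPr (prod2 A)).
Qed.

HB.instance Definition _ :=
  bilinear_isBilinear.Build F ideal A ideal _ _ ideal_act ideal_act_bilinear.

Definition ideal_gen (v : V) : ideal := Ideal (asboolT (right_ideal_gen v)).

Lemma ideal_gen_is_linear : linear ideal_gen.
Proof. by move=> c x y; apply: val_inj; exact: (linearP i). Qed.

HB.instance Definition _ :=
  GRing.isLinear.Build F V ideal *:%R ideal_gen ideal_gen_is_linear.

Lemma As2_prod1_free : is_As2 i -> is_free_assoc (prod1 A).
Proof.
move=> freeA.
pose f : {linear ideal -> A} := val.
have f_act w a : f (ideal_act w a) = prod2 A (f w) a by [].
have actA w a b : ideal_act (ideal_act w a) b = ideal_act w (prod2 A a b).
  by apply: val_inj; rewrite /= prod2A.
pose T := compat_tensor f_act actA.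
pose phi : {linear T -> A} := tensor_ext (prod1 A) f.
have [phi1 phi2] : compat_morphism phi := tensor_ext_compat f_act actA.
have phi_gen w : phi (tensor_gen w) = val w by exact: tensor_ext_gen.
pose j : {linear V -> T} := @tensor_gen F ideal \o ideal_gen.
have [psi [[psi1 psi2] psi_j]] := (freeA T j).1.
(* phi \o psi and the identity are endomorphisms of A that agree on i(V). *)
have psiK : cancel psi phi.
  pose phipsi : {linear A -> A} := phi \o psi; pose idA : {linear A -> A} := idfun.
  apply: ((freeA A i).2 phipsi idA) => //.
  - by split=> x y /=; rewrite ?(psi1, psi2) ?(phi1, phi2).
  - move=> v; rewrite /phipsi /=.
    by have := psi_j v; rewrite /= => ->; rewrite phi_gen.
(* Elements w of the ideal such that psi w = w form a right ideal: this is
   where psiK enters, since the second product on T sees its right factor only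
   through phi. *)
have psi_ideal x : right_ideal x -> forall w, val w = x -> psi x = tensor_gen w.
  elim=> {x} [v w vw|c x y Rx IHx Ry IHy w vw|x a Rx IH w vw].
  - by have := psi_j v; rewrite /= => ->; congr tensor_gen; apply: val_inj.
  - rewrite linearP (IHx (Ideal (asboolT Rx))) // (IHy (Ideal (asboolT Ry))) //.
    by rewrite -linearP; congr tensor_gen; apply: val_inj; rewrite linearP.
  - rewrite psi2 (IH (Ideal (asboolT Rx))) // [LHS]tensor_mul2_gen psiK.
    by congr tensor_gen; apply: val_inj.
have phiK : cancel phi psi.
  apply: tensor_ind => [c x y IHx IHy|w|w x IH].
  - by rewrite !linearP IHx IHy.
  - by rewrite phi_gen (psi_ideal _ (ideal_right w) w).
  - rewrite [phi _]phi1 psi1 IH; congr (prod1 T _ x).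
    by rewrite phi_gen (psi_ideal _ (ideal_right w) w).
by exists ideal, phi; split; [exists psi | exact: phi1].
Qed.

End RightIdeal.

(** * Exchanging the two products *)

Section Swap.
Variable F : fieldType.

Definition compat_swap (A : compat_alg F) : compat_alg F.
Proof.
refine (@CompatAlg F A (prod2 A) (prod1 A) (@prod2A F A) (@prod1A F A) _).
by move=> a b c; rewrite addrC prod12_compat addrC.
Defined.

Lemma is_As2_swap (V : lmodType F) (A : compat_alg F) (i : {linear V -> A}) :
  is_As2 i -> is_As2 (A := compat_swap A) i.
Proof.
move=> freeA B f; have [[g [[g1 g2] gi]] uniq] := freeA (compat_swap B) f.
split; first by exists g.
by move=> g' h [? ?] [? ?]; apply: uniq.
Qed.

End Swap.

Theorem theorem5 (F : fieldType) (char0 : [pchar F] =i pred0)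
    (V : lmodType F) (A : compat_alg F) (i : {linear V -> A})
    (freeA : is_As2 i) :
  is_free_assoc (prod1 A) /\ is_free_assoc (prod2 A).
Proof.
split; first exact: As2_prod1_free freeA.
exact: (As2_prod1_free (is_As2_swap freeA)).
Qed.
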